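(* Let $p$ be an odd prime and let $n$ be a positive integer. Let $G_1$ and $G_2$ be connected graphs of orders $3p$ and $n$, respectively, and suppose that $G_2$ has size $n-1$. Let $g_1:V(G_1)\to\{1,2,\ldots,3p\}$ be a bijection, and put $$\varrho_1=\{ab\in E(G_1):([g_1(a)+g_1(b)]/p)=1\},$$ $$\eta_1=\{ab\in E(G_1):([g_1(a)+g_1(b)]/p)=-1\text{ or }g_1(a)+g_1(b)\equiv 0\pmod p\}.$$ If $$|\varrho_1|=|\eta_1|+1,$$ then the strong product graph $G_1\boxtimes G_2$ is a Legendre cordial graph modulo $p$.
   Context: All graphs are finite, simple, and connected. The order and size of a graph are its number of vertices and its number of edges, respectively. Products: the following graphs all have vertex set $V(G_1)\times V(G_2)$. The cartesian product $G_1\square G_2$ has edge set $\{(v_1,u_1)(v_2,u_2): v_1=v_2\text{ and }u_1u_2\in E(G_2),\text{ or }u_1=u_2\text{ and }v_1v_2\in E(G_1)\}$. The tensor product $G_1\times G_2$ has edge set $\{(v_1,u_1)(v_2,u_2): v_1v_2\in E(G_1)\text{ and }u_1u_2\in E(G_2)\}$. The strong product $G_1\boxtimes G_2$ has edge set $E(G_1\square G_2)\cup E(G_1\times G_2)$. Legendre symbol: for an odd prime $p$ and an integer $a$ relatively prime to $p$, $(a/p)=1$ if $x^2\equiv a\pmod p$ has a solution and $(a/p)=-1$ otherwise. Legendre cordial labeling: let $p$ be an odd prime and $H$ a simple connected graph of order $N$. A bijection $f:V(H)\to\{1,2,\ldots,N\}$ is a Legendre cordial labeling modulo $p$ if the induced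 function $f_p^*:E(H)\to\{0,1\}$, defined by $f_p^*(uv)=0$ if $([f(u)+f(v)]/p)=-1$ or $f(u)+f(v)\equiv 0\pmod p$, and $f_p^*(uv)=1$ if $([f(u)+f(v)]/p)=1$, satisfies $|e_{f_p^*}(0)-e_{f_p^*}(1)|\leq 1$, where $e_{f_p^*}(i)$ is the number of edges with label $i$ ($i=0,1$). A graph admitting such a labeling is called a Legendre cordial graph modulo $p$. *)

(* Defs.v *)
From HB Require Import structures.
From mathcomp Require Import all_boot all_order all_algebra.

Set Implicit Arguments.
Unset Strict Implicit.
Unset Printing Implicit Defensive.

Import Order.TTheory GRing.Theory Num.Theory.

Local Open Scope nat_scope.

Record sgraph := SGraph {
  vertex :> finType;
  adj : rel vertex;
  adj_sym : symmetric adj;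
  adj_irrefl : irreflexive adj
}.

Definition edges (G : sgraph) : {set {set G}} :=
  [set [set x; y] | x in G, y in G & adj x y].

Definition graph_order (G : sgraph) : nat := #|G|.
Definition graph_size (G : sgraph) : nat := #|edges G|.

Definition connected_graph (G : sgraph) : Prop :=
  0 < graph_order G /\ forall x y : G, connect (@adj G) x y.

Section Products.
Variables G1 G2 : sgraph.

Definition cartesian_adj : rel (G1 * G2) := fun x y =>
  (x.1 == y.1) && adj x.2 y.2 || (x.2 == y.2) && adj x.1 y.1.

Definition tensor_adj : rel (G1 * G2) := fun x y =>
  adj x.1 y.1 && adj x.2 y.2.

Definition strong_adj : rel (G1 * G2) := fun x y =>
  cartesian_adj x y || tensor_adj x y.

Lemma strong_adj_sym : symmetric strong_adj.
Proof.
move=> x y; rewrite /strong_adj /cartesian_adj /tensor_adj.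
by rewrite (eq_sym x.1) (eq_sym x.2) (adj_sym x.1) (adj_sym x.2).
Qed.

Lemma strong_adj_irrefl : irreflexive strong_adj.
Proof.
by move=> x; rewrite /strong_adj /cartesian_adj /tensor_adj !adj_irrefl !andbF.
Qed.

Definition strong_product : sgraph := SGraph strong_adj_sym strong_adj_irrefl.

End Products.

(* The symbol is extended by 0 to the multiples of p, so that the equations
   [legendre p a = 1] and [legendre p a = -1] entail that a is prime to p. *)
Definition legendre (p : nat) (a : int) : int :=
  if (p %| a)%Z then 0%R
  else if [exists x : 'I_p, ((x%:Z ^+ 2)%R == a %[mod p])%Z] then 1%R
  else (-1)%R.

(* The bounded search in [legendre] decides solvability over the integers. *)
Lemma legendre_solvableP (p : nat) (a : int) : 0 < p ->
  reflect (exists x : int, ((x ^+ 2)%R = a %[mod p])%Z)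
          [exists x : 'I_p, ((x%:Z ^+ 2)%R == a %[mod p])%Z].
Proof.
move=> p_gt0; apply: (iffP existsP) => [[x /eqP xE]|[x xE]].
  by exists (Posz x).
have p_neq0 : (p%:Z != 0)%R by rewrite eqz_nat -lt0n.
have r_ge0 := modz_ge0 x p_neq0.
have rE : (`|(x %% p)%Z|%N%:Z = (x %% p)%Z)%R by rewrite gez0_abs.
have r_lt : `|(x %% p)%Z|%N < p.
  by rewrite -ltz_nat rE ltz_pmod // ltz_nat.
by exists (Ordinal r_lt); rewrite /= rE modzXm xE.
Qed.

Definition bijective_onto_1_to (T : finType) (N : nat) (f : T -> nat) : Prop :=
  injective f /\ forall k : nat, 1 <= k <= N <-> exists x : T, f x = k.

Section Labeling.
Variables (p : nat) (H : sgraph) (f : H -> nat).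

Definition edge_legendre (u v : H) : int := legendre p (f u + f v)%N.

Definition residue_edges : {set {set H}} :=
  [set [set u; v] | u in H, v in H & adj u v && (edge_legendre u v == 1%R)].

Definition nonresidue_edges : {set {set H}} :=
  [set [set u; v] | u in H, v in H &
    adj u v && ((edge_legendre u v == (-1)%R) || (f u + f v == 0 %[mod p]))].

(* For p > 0 the three cases of [edge_legendre] are exhaustive, so the
   [else] branch is: symbol -1, or sum divisible by p. *)
Definition induced_label (u v : H) : nat :=
  if edge_legendre u v == 1%R then 1 else 0.

Definition label_count (i : nat) : nat :=
  #|[set [set u; v] | u in H, v in H & adj u v && (induced_label u v == i)]|.

Definition legendre_cordial_labeling : Prop :=
  bijective_onto_1_to (graph_order H) f /\
  (`|(label_count 0)%:Z - (label_count 1)%:Z| <= 1)%R.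

End Labeling.

Definition legendre_cordial_graph (p : nat) (H : sgraph) : Prop :=
  connected_graph H /\ exists f : H -> nat, legendre_cordial_labeling p f.

(* Main.v *)
Require Import Defs.
From HB Require Import structures.
From mathcomp Require Import all_boot all_order all_algebra.
From mathcomp Require Import zify ring.

(** Number the vertices of [G2] by [0, 1, ..., n - 1] and give [(v, u)] the label
    [g1 v + 3 * p * j], where [j] is the number of [u].  This is a bijection
    onto [1 .. 3 * p * n], and modulo [p] it forgets [u], so the label of an
    edge of the strong product only depends on the first coordinates of its
    ends.  Count edges with sign: [+1] if the sum of the labels is a nonzero
    square modulo [p], [-1] otherwise.

    - An edge of [G1] with its ends [a, b] gives [n] edges inside the copies of
      [G1], and two edges [(a, u) (b, u')], [(a, u') (b, u)] for each of the
      [n - 1] edges [u u'] of [G2].  The signed count over [G1] is 1 by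
      hypothesis, so these contribute [n + 2 * (n - 1)].
    - A vertex [v] of [G1] gives one edge [(v, u) (v, u')] for each edge of
      [G2], of label sum [2 * g1 v] modulo [p].  As [v] varies, [2 * g1 v] takes
      each residue modulo [p] three times; since there are [(p - 1) / 2] nonzero
      squares, the signs over a complete residue system add up to [-1]
      ([sum_residue_sign_double]).  These edges contribute [- 3 * (n - 1)].

    The total is [n + 2 * (n - 1) - 3 * (n - 1) = 1].  The factorization of the
    count is [sum_strong_adj].  It is carried out with sums over ordered pairs
    of vertices, where products of graphs become products of indicators; every
    edge is then counted twice ([sum_rel]). *)

Set Implicit Arguments.
Unset Strict Implicit.
Unset Printing Implicit Defensive.

Import Order.TTheory GRing.Theory Num.Theory.

Local Open Scope ring_scope.

(** * Counting *)

(** Serves both to pass from ordered pairs to edges and to count squares: each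
    edge comes from two ordered pairs, each nonzero square has two roots. *)
Lemma card_imset_fibers (aT rT : finType) (f : aT -> rT) (A : {set aT}) k :
  (forall x, x \in A -> #|[set y in A | f y == f x]| = k) ->
  #|A| = (k * #|f @: A|)%N.
Proof.
move=> fiberE; rewrite -sum1_card (partition_big_imset f) /=.
rewrite mulnC -sum_nat_const; apply: eq_bigr => _ /imsetP[x xA ->].
by rewrite -(fiberE _ xA) -sum1dep_card.
Qed.

Lemma card_unordered_pairs (T : finType) (r : rel T) :
  symmetric r -> irreflexive r ->
  #|[set z : T * T | r z.1 z.2]|
    = (2 * #|[set [set x; y] | x in T, y in T & r x y]|)%N.
Proof.
move=> r_sym r_irr; pose pairset (z : T * T) := [set z.1; z.2].
have -> : [set [set x; y] | x in T, y in T & r x y]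
          = pairset @: [set z : T * T | r z.1 z.2].
  apply/setP=> e; apply/imset2P/imsetP => [[x y _]|[[x y]]].
    by rewrite inE => /andP[_ rxy] ->; exists (x, y); rewrite ?inE.
  by rewrite inE /= => rxy ->; exists x y; rewrite ?inE.
apply: card_imset_fibers => -[x y]; rewrite inE /= => rxy.
have neq_xy : x != y by apply: contraTneq rxy => ->; rewrite r_irr.
have -> : 2%N = #|[set (x, y); (y, x)]|.
  by rewrite cards2 xpair_eqE (negPf neq_xy).
congr #|pred_of_set _|; apply/setP=> -[a b]; rewrite !inE !xpair_eqE /pairset /=.
apply/andP/orP => [[rab /eqP/setP ab_xy]|].
  have neq_ab : a != b by apply: contraTneq rab => ->; rewrite r_irr.
  move: (ab_xy a) (ab_xy b) neq_ab; rewrite !inE !eqxx orbT /=.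
  move=> /esym/orP[/eqP->|/eqP->] /esym/orP[/eqP->|/eqP->];
    rewrite ?eqxx //; by [left | right].
by case=> /andP[/eqP-> /eqP->]; rewrite 1?setUC // 1?r_sym // eqxx.
Qed.

Lemma sum_bij_onto (V : nmodType) (T : finType) N (f : T -> nat) (F : nat -> V) :
  bijective_onto_1_to N f -> \sum_x F (f x) = \sum_(k < N) F k.+1.
Proof.
case=> f_inj f_onto.
have f_range x : (0 < f x <= N)%N by apply/f_onto; exists x.
have f_lt x : ((f x).-1 < N)%N by move: (f_range x); lia.
pose h x := Ordinal (f_lt x).
have h_inj : injective h.
  move=> x y [] /= fxy; apply: f_inj.
  by move: (f_range x) (f_range y); lia.
have h_onto (k : 'I_N) : k \in codom h.
  have /f_onto[x fx] : (0 < k.+1 <= N)%N by rewrite ltn_ord.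
  by apply/codomP; exists x; apply: val_inj; rewrite /= fx.
have [|h' hK h'K] := inj_card_bij h_inj.
  by rewrite -(card_codom h_inj); apply/subset_leq_card/subsetP => k _.
rewrite (reindex h) /=; last by exists h' => ? _.
by apply: eq_bigr => x _; congr F; move: (f_range x); lia.
Qed.

Lemma sum_periodic (V : nmodType) (F : nat -> V) p m :
  (forall k, F (k + p)%N = F k) ->
  \sum_(k < m * p) F k = (\sum_(k < p) F k) *+ m.
Proof.
move=> FD; have FDM i k : F (k + i * p)%N = F k.
  by elim: i k => [|i IHi] k; rewrite ?mul0n ?addn0 // mulSn addnA IHi FD.
elim: m => [|m IHm]; first by rewrite mul0n big_ord0.
rewrite mulSnr big_split_ord IHm /= mulrSr; congr (_ + _).
by apply: eq_bigr => k _; rewrite addnC FDM.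
Qed.

(** * Quadratic residues *)

Definition nonzero_squares (F : finFieldType) : {set F} :=
  [set x ^+ 2 | x in [set~ 0]].

(** Each [x != 0] has the same square as exactly one other element, [- x], which
    differs from [x] as [2] is invertible. *)
Lemma card_nonzero_squares (F : finFieldType) :
  (2%:R : F) != 0 -> #|F| = (2 * #|nonzero_squares F|).+1.
Proof.
move=> two_neq0; rewrite -(@card_imset_fibers F F (fun x => x ^+ 2)).
  by rewrite cardsC1 prednK //; apply/card_gt0P; exists 0.
move=> x; rewrite !inE => x_neq0.
have neq_xNx : x != - x by rewrite -addr_eq0 -mulr2n -mulr_natl mulf_neq0.
transitivity #|[set x; - x]|; last by rewrite cards2 neq_xNx.
congr #|pred_of_set _|; apply/setP=> y; rewrite !inE /= eqf_sqr.
by case: (eqVneq y 0) => // ->; rewrite eq_sym (negPf x_neq0) eq_sym oppr_eq0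
  (negPf x_neq0).
Qed.

(** Unlike the Legendre symbol, this is [-1] on multiples of [p]: those sums give
    an edge the label 0. *)
Definition residue_sign (p m : nat) : int :=
  if legendre p m == 1 then 1 else -1.

Lemma legendre_eq1 (p m : nat) : prime p ->
  (legendre p m == 1) = ((m%:R : 'F_p) \in nonzero_squares 'F_p).
Proof.
move=> p_pr.
have eqFp a b : ((a%:R : 'F_p) == b%:R) = (a == b %[mod p])%N.
  by rewrite -val_eqE /= !val_Fp_nat.
rewrite /legendre.
have -> : (p %| m%:Z)%Z = ((m%:R : 'F_p) == 0) by rewrite (eqFp m 0%N) mod0n.
case: (eqVneq (m%:R : 'F_p)) => [->|m_neq0] /=.
  apply/esym/negbTE/imsetP => -[x]; rewrite !inE => x_neq0 /esym/eqP.
  by rewrite sqrf_eq0 (negPf x_neq0).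
have -> : (if [exists x : 'I_p, (x%:Z ^+ 2 == m%:Z %[mod p])%Z] then 1 else -1)
    == 1 :> int = [exists x : 'I_p, (x%:Z ^+ 2 == m%:Z %[mod p])%Z] by case: ifP.
apply/existsP/imsetP => [[x]|[x]].
  rewrite expr2 -PoszM !modz_nat eqz_nat -eqFp natrM -expr2 => /eqP x2m.
  by exists (x%:R); rewrite ?inE // -sqrf_eq0 x2m.
rewrite !inE => _ m_eq.
have x_lt : (x < p)%N by rewrite -[X in (_ < X)%N](Fp_cast p_pr).
exists (Ordinal x_lt).
by rewrite /= expr2 -PoszM !modz_nat eqz_nat -eqFp natrM natr_Zp m_eq expr2.
Qed.

Lemma residue_sign_Fp p m : prime p -> residue_sign p m =
  if (m%:R : 'F_p) \in nonzero_squares 'F_p then 1 else -1.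
Proof. by move=> p_pr; rewrite /residue_sign legendre_eq1. Qed.

Lemma residue_sign_modn (p a b : nat) : prime p ->
  (a = b %[mod p])%N -> residue_sign p a = residue_sign p b.
Proof.
by move=> p_pr ab; rewrite !residue_sign_Fp // -(Fp_nat_mod p_pr a) ab Fp_nat_mod.
Qed.

(** The map sending [x] to [2 * (x + 1)] permutes ['F_p], so this is the sum of
    the signs of all residues.  With [m] nonzero squares, [p = 2 * m + 1] and
    the sum is [m - (p - m) = -1]. *)
Lemma sum_residue_sign_double p : prime p -> odd p ->
  \sum_(k < p) residue_sign p (k.+1 + k.+1) = -1.
Proof.
move=> p_pr p_odd; pose S := nonzero_squares 'F_p.
have two_neq0 : (2%:R : 'F_p) != 0.
  by rewrite -val_eqE [val _](val_Fp_nat p_pr 2) modn_small ?odd_prime_gt2.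
pose g (x : 'F_p) : 'F_p := 2%:R * (x + 1).
have g_inj : injective g by move=> x y /(mulfI two_neq0)/addIr.
transitivity (\sum_(x : 'F_p) (if g x \in S then 1 else -1 : int)).
  rewrite -(big_mkord xpredT (fun k => residue_sign p (k.+1 + k.+1))).
  rewrite -[X in \sum_(0 <= _ < X) _](Fp_cast p_pr) big_mkord.
  apply: eq_bigr => x _; rewrite residue_sign_Fp // natrD -natr1 natr_Zp.
  by rewrite /g mulr_natl mulr2n.
rewrite -(reindex_inj g_inj (P := xpredT) (F := fun y => if y \in S then 1 else -1)) /=.
rewrite (bigID (mem S)) /= (eq_bigr (fun=> 1)) => [|x ->//].
rewrite [X in _ + X](eq_bigr (fun=> -1)) => [|x /negPf->//].
rewrite !sumr_const mulNrn.
have := card_nonzero_squares two_neq0; have := cardC (mem S); rewrite -/S.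
rewrite (@eq_card _ [predC S] (fun x => x \notin S)) //.
move: #|_| #|_| #|_|; lia.
Qed.

(** * Signed edge counts *)

(** Each edge [x y] occurs twice here, as [(x, y)] and as [(y, x)]. *)
Definition signed_degree_sum (p : nat) (H : sgraph) (f : H -> nat) : int :=
  \sum_(x : H) \sum_(y : H) (adj x y)%:R * residue_sign p (f x + f y).

Lemma sum_rel (T : finType) (r : rel T) : symmetric r -> irreflexive r ->
  \sum_(x : T) \sum_(y : T) (r x y)%:R
    = (2 * #|[set [set x; y] | x in T, y in T & r x y]|)%:R :> int.
Proof.
move=> r_sym r_irr; rewrite -card_unordered_pairs // pair_bigA -sumr_const /=.
by rewrite [RHS]big_mkcond; apply: eq_bigr => z _; rewrite inE; case: (r _ _).
Qed.

Lemma signed_degree_sumE (p : nat) (H : sgraph) (f : H -> nat) :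
  signed_degree_sum p f
    = 2%:R * ((label_count p f 1)%:Z - (label_count p f 0)%:Z).
Proof.
have lab_sym i : symmetric (fun x y => adj x y && (induced_label p f x y == i)).
  by move=> x y; rewrite adj_sym /induced_label /edge_legendre addnC.
have lab_irr i : irreflexive (fun x y => adj x y && (induced_label p f x y == i)).
  by move=> x; rewrite adj_irrefl.
transitivity ((2 * label_count p f 1)%:R - (2 * label_count p f 0)%:R : int);
  last by rewrite mulrBr !natrM !natz.
rewrite /label_count -(sum_rel (lab_sym 1%N) (lab_irr 1%N)).
rewrite -(sum_rel (lab_sym 0%N) (lab_irr 0%N)).
rewrite -sumrB; apply: eq_bigr => x _; rewrite -sumrB; apply: eq_bigr => y _.
rewrite /induced_label /edge_legendre /residue_sign.
by case: adj; case: eqP.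
Qed.

Lemma eq_pair_set (T : finType) (r r' : rel T) : r =2 r' ->
  [set [set x; y] | x in T, y in T & r x y]
    = [set [set x; y] | x in T, y in T & r' x y].
Proof.
move=> rr'; apply/setP=> e.
by apply/imset2P/imset2P => -[x y xT yP ->]; exists x y => //; move: yP;
  rewrite !inE rr'.
Qed.

Lemma residue_edgesE (p : nat) (H : sgraph) (f : H -> nat) :
  #|residue_edges p f| = label_count p f 1.
Proof.
congr #|pred_of_set _|; apply: eq_pair_set => x y.
by rewrite /induced_label; case: (_ == 1).
Qed.

(** The symbol only takes the values 1, -1 and 0, the last one exactly when [p]
    divides the sum; so both sets consist of the edges with symbol other than 1. *)
Lemma nonresidue_edgesE (p : nat) (H : sgraph) (f : H -> nat) :
  #|nonresidue_edges p f| = label_count p f 0.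
Proof.
congr #|pred_of_set _|; apply: eq_pair_set => x y; congr (_ && _).
rewrite /induced_label /edge_legendre /legendre mod0n.
by rewrite dvdzE /= /dvdn; case: (_ == 0%N) => /=; last case: [exists _, _].
Qed.

(** * Strong products *)

Lemma sum_eq_indicator (T : finType) :
  \sum_(x : T) \sum_(y : T) (x == y)%:R = #|T|%:R :> int.
Proof.
rewrite -sumr_const; apply: eq_bigr => x _.
by rewrite (bigD1 x) //= eqxx big1 ?addr0 // => y; rewrite eq_sym => /negPf->.
Qed.

Lemma connect_homo (T T' : finType) (h : T -> T') (e : rel T) (e' : rel T') :
  {homo h : x y / e x y >-> e' x y} ->
  {homo h : x y / connect e x y >-> connect e' x y}.
Proof.
move=> h_homo x _ /connectP[s s_path ->]; apply/connectP.
by exists (map h s); rewrite ?last_map // (homo_path h_homo).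
Qed.

Section StrongProduct.
Variables G1 G2 : sgraph.

(** Walk first in the copy of [G1], then in the copy of [G2]. *)
Lemma strong_product_connected : connected_graph G1 -> connected_graph G2 ->
  connected_graph (strong_product G1 G2).
Proof.
move=> [G1_gt0 G1_conn] [G2_gt0 G2_conn]; split=> [|[v u] [v' u']].
  by rewrite /graph_order card_prod muln_gt0 G1_gt0.
apply: (@connect_trans _ _ (v', u)).
  apply: (connect_homo (h := fun w : G1 => (w, u)) _ (G1_conn v v')) => x y xy.
  by rewrite /= /strong_adj /cartesian_adj /= eqxx xy orbT.
apply: (connect_homo (h := pair v') _ (G2_conn u u')) => x y xy.
by rewrite /= /strong_adj /cartesian_adj /= eqxx xy.
Qed.

(** Adjacency in the strong product is the product of the reflexive closures of
    the two adjacencies, minus the diagonal; the three kinds of edges are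
    disjoint, so the indicators add up. *)
Lemma strong_adj_natr (x y : G1 * G2) :
  (strong_adj x y)%:R = (x.1 == y.1)%:R * (adj x.2 y.2)%:R
    + (adj x.1 y.1)%:R * ((x.2 == y.2)%:R + (adj x.2 y.2)%:R) :> int.
Proof.
case: x y => [v u] [v' u']; rewrite /strong_adj /cartesian_adj /tensor_adj /=.
case: (eqVneq v v') => [->|_]; case: (eqVneq u u') => [->|_];
  rewrite ?adj_irrefl ?orbF ?orbT //=; by do 2?case: adj.
Qed.

(** A weight [s] that only sees the first coordinates comes out of the sum over
    second coordinates: equal first coordinates can be completed by the
    [2 * graph_size G2] adjacent pairs of [G2], adjacent ones also by the
    [graph_order G2] equal pairs. *)
Lemma sum_strong_adj (s : G1 -> G1 -> int) :
  \sum_(x : G1 * G2) \sum_(y : G1 * G2) (strong_adj x y)%:R * s x.1 y.1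
    = (2 * graph_size G2)%:R * (\sum_v s v v)
      + (graph_order G2 + 2 * graph_size G2)%:R
        * \sum_v \sum_v' (adj v v')%:R * s v v'.
Proof.
rewrite natrD -sum_eq_indicator -sum_rel; [|exact: adj_sym|exact: adj_irrefl].
under eq_bigr => x _.
  rewrite -(pair_bigA _ (fun v' u' => (strong_adj x (v', u'))%:R * s x.1 v')).
  over.
rewrite -(pair_bigA _ (fun v u => \sum_v' \sum_u'
  (strong_adj (v, u) (v', u'))%:R * s v v')) /=.
rewrite mulrC mulr_suml mulr_sumr -big_split; apply: eq_bigr => v _ /=.
rewrite exchange_big /=.
(* Fix [v, v'] and sum the indicators over the second coordinates. *)
transitivity (\sum_v' ((v == v')%:R * s v v' *
    (\sum_(u : G2) \sum_(u' : G2) (adj u u')%:R)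
  + (adj v v')%:R * s v v' * (\sum_(u : G2) \sum_(u' : G2) (u == u')%:R
      + \sum_(u : G2) \sum_(u' : G2) (adj u u')%:R)) : int).
  apply: eq_bigr => v' _; rewrite -big_split !mulr_sumr -big_split /=.
  apply: eq_bigr => u _; rewrite -big_split !mulr_sumr -big_split /=.
  by apply: eq_bigr => u' _; rewrite strong_adj_natr /=; ring.
rewrite big_split /= -!mulr_suml (bigD1 v) //= eqxx mul1r big1 ?addr0.
  by congr (_ + _); rewrite mulrC.
by move=> v'; rewrite eq_sym => /negPf->; rewrite mul0r.
Qed.

End StrongProduct.

(** The copy of [G1] over the vertex of rank [j] in [G2] receives the block of
    labels [j * N + 1 .. (j + 1) * N]. *)
Definition product_labeling (G1 G2 : sgraph) N (g : G1 -> nat)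
    (x : strong_product G1 G2) : nat :=
  (g x.1 + enum_rank x.2 * N)%N.

Lemma product_labeling_bij (G1 G2 : sgraph) N (g : G1 -> nat) :
  bijective_onto_1_to N g ->
  bijective_onto_1_to (N * graph_order G2) (@product_labeling G1 G2 N g).
Proof.
case=> g_inj g_onto.
have g_range v : (0 < g v <= N)%N by apply/g_onto; exists v.
(* Labels start at 1: the predecessor makes division by [N] recover the block. *)
have block v (i : nat) : ((g v + i * N).-1 %/ N)%N = i.
  have := g_range v => rv; have N_gt0 : (0 < N)%N by lia.
  have -> : ((g v + i * N).-1 = i * N + (g v).-1)%N by lia.
  by rewrite divnMDl // divn_small ?addn0 //; lia.
rewrite /product_labeling; split=> [[v u] [v' u'] /= eq_lab|k].
  have eq_u : enum_rank u = enum_rank u' :> nat.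
    by rewrite -(block v (enum_rank u)) eq_lab block.
  rewrite (enum_rank_inj (val_inj eq_u)).
  by move: eq_lab; rewrite eq_u => /addIn/g_inj->.
split=> [k_range|[[v u] /= <-]].
  have N_gt0 : (0 < N)%N by case: (posnP N) k_range => // ->; rewrite mul0n; lia.
  have u_lt : (k.-1 %/ N < graph_order G2)%N by rewrite ltn_divLR //; lia.
  have /g_onto[v gv] : (0 < (k.-1 %% N).+1 <= N)%N by rewrite ltn_mod.
  exists (v, enum_val (Ordinal u_lt)); rewrite /= gv enum_valK /=.
  by move: (divn_eq k.-1 N); lia.
have: (enum_rank u < graph_order G2)%N by exact: ltn_ord.
by move: (g_range v) (nat_of_ord (enum_rank u)) (graph_order G2); nia.
Qed.

(** * Cordiality of the strong product *)

Theorem theorem3p8 (p n : nat) (G1 G2 : sgraph) (g1 : G1 -> nat)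
    (p_prime : prime p) (p_odd : odd p) (n_gt0 : (0 < n)%N)
    (G1_connected : connected_graph G1) (G2_connected : connected_graph G2)
    (G1_order : graph_order G1 = (3 * p)%N) (G2_order : graph_order G2 = n)
    (G2_size : graph_size G2 = (n - 1)%N)
    (g1_bij : bijective_onto_1_to (3 * p)%N g1)
    (balance : #|residue_edges p g1| = (#|nonresidue_edges p g1| + 1)%N) :
  legendre_cordial_graph p (strong_product G1 G2).
Proof.
split; first exact: strong_product_connected.
exists (product_labeling (3 * p) g1); split.
  by rewrite /graph_order card_prod -/(graph_order G1) G1_order;
     exact: product_labeling_bij.
have := signed_degree_sumE p (@product_labeling G1 G2 (3 * p) g1).
(* Twice the signed count: [2 * (n - 1) * (-3) + (n + 2 * (n - 1)) * 2 = 2]. *)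
have -> : signed_degree_sum p (@product_labeling G1 G2 (3 * p) g1) = 2%:R.
  transitivity (\sum_(x : G1 * G2) \sum_(y : G1 * G2)
      (strong_adj x y)%:R * residue_sign p (g1 x.1 + g1 y.1)).
    apply: eq_bigr => x _; apply: eq_bigr => y _; congr (_ * _).
    apply: residue_sign_modn => //; rewrite /product_labeling addnACA.
    by rewrite -mulnDl mulnA addnC modnMDl.
  rewrite (sum_strong_adj G2 (fun v v' => residue_sign p (g1 v + g1 v'))).
  rewrite (sum_bij_onto (fun k => residue_sign p (k + k)) g1_bij).
  rewrite (sum_periodic (F := fun k => residue_sign p (k.+1 + k.+1))); last first.
    move=> k; apply: residue_sign_modn => //.
    by rewrite -addSn addnACA addnA !modnDr.
  rewrite sum_residue_sign_double // -/(signed_degree_sum p g1).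
  rewrite signed_degree_sumE -residue_edgesE -nonresidue_edgesE balance.
  rewrite G2_order G2_size.
  lia.
lia.
Qed.
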